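(* Let $\mathscr{A}\in\mathbb{C}^{n\times n\times p}$ and let $[\lambda]$ be a tubular eigenvalue of $\mathscr{A}$ with corresponding eigentensor $\mathscr{X}\in\mathbb{C}^{n\times1\times p}$. If the vector $d\in\mathbb{C}^p$ and the matrix $X\in\mathbb{C}^{n\times p}$ satisfy $$d_1=[\lambda]_{111},\qquad d_i=[\lambda]_{11(p-i+2)}\ \text{ for } i=2,3,\ldots,p,\qquad \mathrm{vec}(X)=\mathrm{Unfold}(\mathscr{X}),$$ then $d$ is an eigentuple of $\mathscr{A}$ with corresponding eigenmatrix $X$.
   Context: For a tensor $\mathscr{X}\in\mathbb{C}^{n\times m\times p}$, $X_k\in\mathbb{C}^{n\times m}$ ($k=1,\dots,p$) denotes the $k$-th frontal slice (third index fixed to $k$). $\mathrm{Unfold}(\mathscr{X})\in\mathbb{C}^{np\times m}$ stacks $X_1,\dots,X_p$ vertically in this order, and $\mathrm{Fold}$ is its inverse. $\mathrm{bcirc}(\mathscr{X})\in\mathbb{C}^{np\times mp}$ is the block-circulant matrix whose $(i,j)$ block is $X_{((i-j)\bmod p)+1}$. The T-product of $\mathscr{X}\in\mathbb{C}^{n\times m\times p}$ and $\mathscr{Y}\in\mathbb{C}^{m\times\ell\times p}$ is $\mathscr{X}*\mathscr{Y}=\mathrm{Fold}(\mathrm{bcirc}(\mathscr{X})\,\mathrm{Unfold}(\mathscr{Y}))\in\mathbb{C}^{n\times\ell\times p}$. The conjugate transpose $\mathscr{X}^H\in\mathbb{C}^{m\times n\times p}$ is the tensor with $\mathrm{bcirc}(\mathscr{X}^H)=\mathrm{bcirc}(\mathscr{X})^H$.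 A tubular tensor of length $p$ is a $1\times1\times p$ tensor; for $v\in\mathbb{C}^p$, $[v]$ is the tubular tensor with $[v]_{11j}=v_j$, and $\mathrm{circ}([v])$ is the $p\times p$ circulant matrix with $(i,j)$ entry $v_{((i-j)\bmod p)+1}$. An $n\times n\times p$ tensor is non-singular if it has a two-sided inverse for $*$ with respect to the identity tensor (first frontal slice $I_n$, the others zero); equivalently its $\mathrm{bcirc}$ is a non-singular matrix. Eigentuple: for $X\in\mathbb{C}^{n\times p}$, $\mathscr{A}*_m X\in\mathbb{C}^{n\times p}$ denotes the matrix obtained by viewing $X$ as an $n\times1\times p$ tensor (its $k$-th column being the $k$-th frontal slice), forming the T-product with $\mathscr{A}$ on the left, and reshaping the resulting $n\times 1\times p$ tensor back into an $n\times p$ matrix in the same manner. A vector $d\in\mathbb{C}^p$ is an eigentuple of $\mathscr{A}$ with associated eigenmatrix $X\in\mathbb{C}^{n\times p}$, $X\neq0$, if $\mathscr{A}*_mX=X\,\mathrm{circ}([d])$. Here $\mathrm{vec}(X)$ stacks the columns of $X$. Tubular eigenvalue: a tubular tensor $[\lambda]$ of length $p$ is a tubular eigenvalue of $\mathscr{A}\in\mathbb{C}^{n\times n\times p}$ with (associated) eigentensor $\mathscr{X}\in\mathbb{C}^{n\times1\times p}$ if $\mathscr{A}*\mathscr{X}=\mathscr{X}*[\lambda]$ and the tubular tensor $\mathscr{X}^H*\mathscr{X}$ is non-singular. *)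

(* Defs.v *)
From mathcomp Require Import all_boot all_order all_algebra.

Set Implicit Arguments.
Unset Strict Implicit.
Unset Printing Implicit Defensive.

Import GRing.Theory.
Local Open Scope ring_scope.
Local Open Scope sesquilinear_scope.

(* The tensors of C^(n x m x (p+1)), given by their frontal slices. The third *)
(* dimension is a successor so that it is positive and slice indices carry    *)
(* the arithmetic of Z/(p+1). All indices are 0-based.                        *)
Definition tensor (C : Type) (n m p : nat) : Type :=
  {ffun 'I_p.+1 -> 'M[C]_(n, m)}.

Section TProduct.
Variables (C : pzSemiRingType) (p : nat).

(* The dimension n(p+1) appears as \sum_(k < p.+1) n, the form in which the   *)
(* block matrices of the library have it.                                     *)
Definition tunfold n m (X : tensor C n m p) : 'M[C]_(\sum_(k < p.+1) n, m) :=
  \mxcol_(k < p.+1) X k.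

Definition tfold n m (M : 'M[C]_(\sum_(k < p.+1) n, m)) : tensor C n m p :=
  [ffun k => submxcol (p_ := fun _ => n) M k].

Definition bcirc n m (X : tensor C n m p) :
    'M[C]_(\sum_(i < p.+1) n, \sum_(j < p.+1) m) :=
  \mxblock_(i < p.+1, j < p.+1) X (i - j).

Definition tmul n m l (X : tensor C n m p) (Y : tensor C m l p) :
    tensor C n l p :=
  tfold (bcirc X *m tunfold Y).

Definition tid n : tensor C n n p :=
  [ffun k => if k == 0 then 1%:M else 0].

Definition tnonsingular n (X : tensor C n n p) : Prop :=
  exists Y : tensor C n n p, tmul X Y = tid n /\ tmul Y X = tid n.

Definition tubular (v : 'cV[C]_p.+1) : tensor C 1 1 p := [ffun k => (v k 0)%:M].

Definition circ (t : tensor C 1 1 p) : 'M[C]_p.+1 :=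
  \matrix_(i, j) t (i - j) 0 0.

Definition tensor_of_mx n (X : 'M[C]_(n, p.+1)) : tensor C n 1 p :=
  [ffun k => col k X].

Definition mx_of_tensor n (T : tensor C n 1 p) : 'M[C]_(n, p.+1) :=
  \matrix_(i, k) T k i 0.

Definition tmulm n (A : tensor C n n p) (X : 'M[C]_(n, p.+1)) :
    'M[C]_(n, p.+1) :=
  mx_of_tensor (tmul A (tensor_of_mx X)).

(* Columns stacked, unlike [mxvec], which concatenates the rows. *)
Definition vec n (X : 'M[C]_(n, p.+1)) : 'cV[C]_(\sum_(k < p.+1) n) :=
  \mxcol_(k < p.+1) col k X.

Definition eigentuple n (A : tensor C n n p) (d : 'cV[C]_p.+1)
    (X : 'M[C]_(n, p.+1)) : Prop :=
  X != 0 /\ tmulm A X = X *m circ (tubular d).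

Lemma submxblock_bcirc n m (X : tensor C n m p) i j :
  submxblock (p_ := fun _ => n) (q_ := fun _ => m) (bcirc X) i j = X (i - j).
Proof. exact: mxblockK. Qed.

Lemma bcirc_inj n m : injective (@bcirc n m).
Proof.
move=> X Y eqXY; apply/ffunP => k.
by rewrite -(subr0 k) -!submxblock_bcirc eqXY.
Qed.

End TProduct.

Section ConjugateTranspose.
Variables (C : numClosedFieldType) (p : nat).

(* A block-circulant matrix is determined by its first block column; [bcirc]  *)
(* of the tensor below is bcirc(X)^H, by [bcirc_tconj].                       *)
Definition tconj n m (X : tensor C n m p) : tensor C m n p :=
  [ffun k => submxblock (p_ := fun _ => m) (q_ := fun _ => n)
               ((bcirc X) ^t*) k 0].

Lemma bcirc_tconj n m (X : tensor C n m p) : bcirc (tconj X) = (bcirc X) ^t*.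
Proof.
have blk i j : submxblock (p_ := fun _ => m) (q_ := fun _ => n)
    ((bcirc X) ^t*) i j = (X (j - i)) ^t*.
  by rewrite -submxblock_bcirc; apply/matrixP => a b; rewrite !mxE.
rewrite -[RHS](@submxblockK _ _ _ (fun=> m) (fun=> n)).
apply: (@eq_mxblock _ _ _ (fun=> m) (fun=> n)) => i j.
by rewrite ffunE !blk sub0r opprB.
Qed.

Definition tubular_eigenvalue n (A : tensor C n n p) (lam : tensor C 1 1 p)
    (X : tensor C n 1 p) : Prop :=
  tmul A X = tmul X lam /\ tnonsingular (tmul (tconj X) X).

End ConjugateTranspose.

(* Main.v *)
Require Import Defs.
From mathcomp Require Import all_boot all_order all_algebra.
From mathcomp Require Import complex reals.

Set Implicit Arguments.
Unset Strict Implicit.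
Unset Printing Implicit Defensive.

Local Open Scope ring_scope.
Local Open Scope complex_scope.

Import GRing.Theory.

(** In terms of frontal slices the T-product is a convolution over the cyclic
    group Z/(p+1) ([tmulE]): slice k of X * Y is the sum over j of
    X_(k-j) Y_j. Hence slice k of XX * [lam] is the sum over j of
    lam_(k-j) XX_j, whereas column k of X circ([d]) is the sum over j of
    d_(j-k) X_j ([mulmx_circ_tubular]). Reading indices modulo p+1, the relation
    between d and lam is d_i = lam_(-i) ([reversed_indexE]), so the two agree,
    and A * XX = XX * [lam] becomes the eigentuple equation. Finally X cannot
    vanish: the T-product with a zero tensor is zero, which is not the
    identity, so XX^H * XX would be singular. *)

Section SliceFormulas.

Variables (C : pzSemiRingType) (p : nat).

Lemma tmulE n m l (X : tensor C n m p) (Y : tensor C m l p) k :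
  tmul X Y k = \sum_j X (k - j) *m Y j.
Proof.
rewrite ffunE /bcirc /tunfold.
rewrite (mul_mxblock_mxrow (p_ := fun=> m) (q_ := fun=> n)).
by rewrite (mxcolK (p_ := fun=> n)).
Qed.

Lemma tmul_tubularE n (X : tensor C n 1 p) (t : tensor C 1 1 p) k a :
  tmul X t k a 0 = \sum_j X j a 0 * t (k - j) 0 0.
Proof.
(* The substitution j := k - j moves the shifted index to the second factor. *)
rewrite tmulE summxE (reindex_inj (subrI k)).
by apply: eq_bigr => j _; rewrite mxE big_ord1 subKr.
Qed.

Lemma mulmx_circ_tubular n (X : 'M[C]_(n, p.+1)) (d : 'cV_p.+1) a k :
  (X *m circ (tubular d)) a k = \sum_j X a j * d (j - k) 0.
Proof. by rewrite mxE; apply: eq_bigr => j _; rewrite mxE ffunE mxE. Qed.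

(** The relation vec(X) = Unfold(XX) says that column k of X is slice k. *)
Lemma vec_tunfold n (X : 'M[C]_(n, p.+1)) (XX : tensor C n 1 p) :
  vec X = tunfold XX -> tensor_of_mx X = XX.
Proof.
rewrite /vec /tunfold => /(eq_mxcolP (p_ := fun=> n)) eqX.
by apply/ffunP => k; rewrite ffunE.
Qed.

Lemma tmulr0 n m l (X : tensor C n m p) (Y : tensor C m l p) :
  (forall k, Y k = 0) -> forall k, tmul X Y k = 0.
Proof. by move=> Y0 k; rewrite tmulE big1 // => j _; rewrite Y0 mulmx0. Qed.

Lemma tmul0r n m l (X : tensor C n m p) (Y : tensor C m l p) :
  (forall k, X k = 0) -> forall k, tmul X Y k = 0.
Proof. by move=> X0 k; rewrite tmulE big1 // => j _; rewrite X0 mul0mx. Qed.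

End SliceFormulas.

(** With q = p + 1 slices numbered from 1, the map fixing 1 and sending i > 1
    to q - i + 2 is, once indices start at 0, negation modulo q. *)
Lemma reversed_indexE (T : Type) p (u v : 'I_p.+1 -> T) :
  u 0 = v 0 ->
  (forall i : 'I_p.+1, (0 < i)%N -> u i = v (inord (p.+1 - i))) ->
  forall i, u i = v (- i).
Proof.
move=> uv0 uv i; have [->|i_neq0] := eqVneq i 0; first by rewrite oppr0.
have i_gt0 : (0 < i)%N by rewrite lt0n.
have lt_i : (p.+1 - i < p.+1)%N by rewrite ltn_subrL i_gt0.
by rewrite uv //; congr v; apply: val_inj; rewrite /= inordK // modn_small.
Qed.

Lemma tnonsingular_neq0 (C : nzSemiRingType) p n (X : tensor C n.+1 n.+1 p) :
  tnonsingular X -> ~ (forall k, X k = 0).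
Proof.
move=> [Y [XY1 _]] X0; have /eqP := tmul0r Y X0 0.
by rewrite XY1 ffunE eqxx oner_eq0.
Qed.

Theorem proposition2p9 (R : realType) (n p : nat)
    (A : tensor R[i] n n p) (lam : tensor R[i] 1 1 p) (XX : tensor R[i] n 1 p)
    (d : 'cV[R[i]]_p.+1) (X : 'M[R[i]]_(n, p.+1)) :
  tubular_eigenvalue A lam XX ->
  d 0 0 = lam 0 0 0 ->
  (forall i : 'I_p.+1, (0 < i)%N -> d i 0 = lam (inord (p.+1 - i)) 0 0) ->
  vec X = tunfold XX ->
  eigentuple A d X.
Proof.
move=> [AXX XHX_ns] d0 d_rev /vec_tunfold eqX.
have dE := reversed_indexE (u := d^~ 0) (v := fun i => lam i 0 0) d0 d_rev.
split.
  apply/eqP => X0; apply: (tnonsingular_neq0 XHX_ns); apply: tmulr0 => k.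
  by rewrite -eqX ffunE X0 col0.
apply/matrixP => a k.
rewrite mulmx_circ_tubular mxE eqX AXX tmul_tubularE.
apply: eq_bigr => j _.
by rewrite dE opprB -eqX ffunE mxE.
Qed.
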